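(* Let $q=r^2$ where $r$ is an odd prime power, and let $q-1=e_1f_1=e_2f_2$ with positive integers $e_1,f_1,e_2,f_2$. Suppose there is an integer $l\geq 2$ with $e_1\equiv 2^l \pmod{2^{l+1}}$ and $2^l\mid e_2$. Suppose further that $2e_2\mid e_1(r+1)$ and $e_1\mid e_2(r-1)$. Let $D_1=\frac{e_1}{\gcd(e_1,e_2)}$, $D_2=\frac{e_2}{\gcd(e_1,e_2)}$, let $s,t$ be integers with $1\leq s\leq D_1$, $1\leq t\leq D_2$, and put $n_1=sf_1+tf_2$. Then: (1) if both $\frac{te_1(r+1)}{2e_2}+\frac{r+1}{2}$ and $n_1$ are even, then for every $k$ with $1\leq k\leq \frac{n_1}{2}-1$ there exists a $q$-ary $[n_1,k]$ MDS self-orthogonal code; (2) if $\frac{t(r+1)e_1}{2e_2}$, $\frac{r+1}{2}$ and $n_1$ are all even, there exists a $q$-ary MDS almost self-dual code of length $n_1+1$; (3) if both $\frac{te_1(r+1)}{2e_2}+\frac{t(r+1)}{2}$ and $\frac{(t-1)(r+1)}{2}$ are even and $n_1$ is odd, then for every $k$ with $1\leq k\leq \frac{n_1+1}{2}-1$ there exists a $q$-ary $[n_1+1,k]$ MDS self-orthogonal code.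
   Context: $\mathbb{F}_q$ denotes the finite field with $q$ elements. A linear code of length $n$ over $\mathbb{F}_q$ is a subspace of $\mathbb{F}_q^n$; an $[n,k]$ code has dimension $k$, and an $[n,k,d]$ code is MDS if its minimum Hamming distance is $d=n-k+1$. The (Euclidean) dual of a code $C$ is $C^\perp=\{x\in\mathbb{F}_q^n : \sum_i x_ic_i=0 \text{ for all } c\in C\}$. $C$ is self-orthogonal if $C\subseteq C^\perp$, and almost self-dual if $C\subseteq C^\perp$ and $\dim C^\perp=\dim C+1$. An MDS almost self-dual code is an almost self-dual code that is MDS. *)

(* Defs.v *)
From HB Require Import structures.
From mathcomp Require Import all_boot all_order all_algebra all_field.
Set Implicit Arguments. Unset Strict Implicit. Unset Printing Implicit Defensive.
Import GRing.Theory.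
Local Open Scope ring_scope.

(* A linear code of length n over F is represented by a matrix C whose row
   space is the code (the rows need not be independent). *)
Section Codes.
Variable F : fieldType.

Definition hwt (n : nat) (x : 'rV[F]_n) : nat := #|[set i | x 0 i != 0]|.

Definition code_dim (m n : nat) (C : 'M[F]_(m, n)) : nat := \rank C.

Definition dual_code (m n : nat) (C : 'M[F]_(m, n)) : 'M[F]_n := kermx C^T.

Definition is_min_dist (m n : nat) (C : 'M[F]_(m, n)) (d : nat) : Prop :=
  (exists x : 'rV[F]_n, [/\ (x <= C)%MS, x != 0 & hwt x = d]) /\
  (forall x : 'rV[F]_n, (x <= C)%MS -> x != 0 -> (d <= hwt x)%N).

Definition is_MDS (m n : nat) (C : 'M[F]_(m, n)) : Prop :=
  is_min_dist C (n - code_dim C + 1)%N.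

Definition self_orthogonal (m n : nat) (C : 'M[F]_(m, n)) : Prop :=
  (C <= dual_code C)%MS.

Definition almost_self_dual (m n : nat) (C : 'M[F]_(m, n)) : Prop :=
  self_orthogonal C /\ \rank (dual_code C) = (code_dim C + 1)%N.

End Codes.

(* Main.v *)
Require Import Defs.
From HB Require Import structures.
From mathcomp Require Import all_boot all_order all_algebra all_field.
From mathcomp Require Import fingroup cyclic ring zify.
Set Implicit Arguments.
Unset Strict Implicit.
Unset Printing Implicit Defensive.
Import GRing.Theory.
Local Open Scope ring_scope.

(* Let z generate the units of F, put D = e2 * f1 and Z = (e1 / 2) * f2, and take
   as evaluation points the roots of P = P1 P2, where P1 is the product of the
   X^f1 - z^(D i) for i < s and P2 the product of the X^f2 - z^(Z (2 j + 1)) for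
   j < t.  The exponents (to the base z) of the roots of P1 are divisible by 2^l,
   those of P2 only by 2^(l-1), so P has s f1 + t f2 distinct roots.  Here z^D
   lies in the subfield of order r and z^Z has norm 1.  A difference of elements
   of the subfield is a square in F; for x, y of norm 1 conjugation gives
   (x - y)^(r-1) = - 1 / (x y), which determines the quadratic character of
   x - y.  Hence the quadratic character of P'(x) is constant on the roots of P1
   and on those of P2, and the parity hypotheses make both constants agree.  The
   multipliers v(x) with v(x)^2 = c / P'(x) then turn the generalised
   Reed-Solomon code into a self-orthogonal one.  In (2) and (3) the point 0 is
   added; all points being squares, P'(x) keeps its quadratic character. *)

(** * Derivatives at roots and Lagrange interpolation *)

Lemma deriv_prod_XsubC_root (F : fieldType) (I : finType) (x : I -> F) (i : I) :
  (\prod_j ('X - (x j)%:P))^`().[x i] = \prod_(j | j != i) (x i - x j).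
Proof.
rewrite (bigD1 i) //= derivM derivXsubC mul1r !hornerE subrr mul0r addr0.
by rewrite horner_prod; apply: eq_bigr => j _; rewrite hornerXsubC.
Qed.

Lemma prod_sub_neq0 (F : fieldType) (I : finType) (x : I -> F) (i : I) :
  injective x -> \prod_(j | j != i) (x i - x j) != 0.
Proof.
move=> xI; apply/prodf_neq0 => j ji; rewrite subr_eq0.
by apply: contra ji => /eqP/xI->.
Qed.

(* The sum is the coefficient of degree n - 1 of the Lagrange interpolant of f,
   which is f itself. *)
Lemma sum_div_prod_sub_eq0 (F : fieldType) (n : nat) (x : 'I_n -> F)
    (f : {poly F}) :
  injective x -> (size f < n)%N ->
  \sum_i f.[x i] / \prod_(j | j != i) (x i - x j) = 0.
Proof.
move=> xI sf; have n_gt0 : (0 < n)%N by apply: leq_ltn_trans sf.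
pose d i := \prod_(j | j != i) (x i - x j).
pose L i := \prod_(j | j != i) ('X - (x j)%:P).
have sL i : size (L i) = n.
  rewrite /L -big_filter size_prod_XsubC size_filter -sum1_count sum1_card.
  by rewrite cardC1 card_ord prednK.
have L1 i : (L i)`_n.-1 = 1.
  by rewrite -[in n.-1](sL i); apply/eqP/monic_prod_XsubC.
pose g := \sum_i (f.[x i] / d i) *: L i.
have gE i : g.[x i] = f.[x i].
  rewrite horner_sum (bigD1 i) //= big1 ?addr0 => [|k ki].
    rewrite hornerZ horner_prod (eq_bigr (fun j => x i - x j)).
      by rewrite divfK ?prod_sub_neq0.
    by move=> j _; rewrite hornerXsubC.
  rewrite hornerZ horner_prod (bigD1 i) 1?eq_sym //= hornerXsubC subrr.
  by rewrite mul0r mulr0.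
have fg : f = g.
  have sg : (size g <= n)%N.
    apply: (leq_trans (size_sum _ _ _)); apply/bigmax_leqP => i _.
    by rewrite (leq_trans (size_scale_leq _ _)) ?sL.
  have sfg : (size (f - g)%R <= n)%N.
    by rewrite (leq_trans (size_polyD _ _)) // size_polyN geq_max (ltnW sf).
  apply/eqP; rewrite -subr_eq0; apply: contraLR sfg => fg0; rewrite -ltnNge.
  have := max_poly_roots (rs := [seq x i | i <- enum 'I_n]) fg0.
  rewrite map_inj_uniq ?enum_uniq // size_map size_enum_ord; apply=> //.
  by apply/allP => _ /mapP[i _ ->]; rewrite /root !hornerE gE subrr.
have: g`_n.-1 = 0 by rewrite -fg nth_default // -ltnS prednK.
rewrite coef_sum => g0; rewrite -[RHS]g0; apply: eq_bigr => i _.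
by rewrite coefZ L1 mulr1.
Qed.

(** * Generalised Reed-Solomon codes *)

Definition grs_code (F : fieldType) (k n : nat) (x v : 'I_n -> F) : 'M[F]_(k, n) :=
  \matrix_(j < k, i < n) (v i * x i ^+ j).

Lemma mul_grs_code (F : fieldType) (k n : nat) (x v : 'I_n -> F) (u : 'rV_k) i :
  (u *m grs_code k x v) 0 i = v i * (rVpoly u).[x i].
Proof.
rewrite mxE horner_poly mulr_sumr; apply: eq_bigr => j _.
by rewrite mxE valK mulrCA.
Qed.

Lemma hwt_grs_code (F : fieldType) (k n : nat) (x v : 'I_n -> F) (u : 'rV_k) :
  (forall i, v i != 0) ->
  (hwt (u *m grs_code k x v) + #|[set i | root (rVpoly u) (x i)]| = n)%N.
Proof.
move=> v0; rewrite -[RHS](card_ord n).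
rewrite -[RHS](cardC [set i | root (rVpoly u) (x i)]).
rewrite addnC; congr addn; apply: eq_card => i.
by rewrite !inE mul_grs_code mulf_eq0 (negPf (v0 i)).
Qed.

(** A nonzero polynomial of size at most [k] has fewer than [k] roots. The additive form avoids
    truncated subtraction. *)
Lemma hwt_grs_code_ge (F : fieldType) (k n : nat) (x v : 'I_n -> F) (u : 'rV_k) :
  injective x -> (forall i, v i != 0) -> u != 0 ->
  (n < hwt (u *m grs_code k x v) + k)%N.
Proof.
move=> xI v0 u0; have nE := hwt_grs_code x u v0.
suff : (#|[set i | root (rVpoly u) (x i)]| < k)%N by lia.
have pu0 : rVpoly u != 0.
  by apply: contra u0 => /eqP pu; rewrite -[u]rVpolyK pu linear0.
have := max_poly_roots
  (rs := [seq x i | i in [set i | root (rVpoly u) (x i)]]) pu0.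
rewrite map_inj_uniq ?enum_uniq // size_map -cardE => /(_ _ isT) le_roots.
apply: leq_trans (size_poly _ _); apply: le_roots.
by apply/allP => y /mapP[i]; rewrite mem_enum inE => ri ->.
Qed.

Lemma rank_grs_code (F : fieldType) (k n : nat) (x v : 'I_n -> F) :
  injective x -> (forall i, v i != 0) -> (k <= n)%N ->
  \rank (grs_code k x v) = k.
Proof.
move=> xI v0 kn; apply/eqP; rewrite -[_ == _]/(row_free _) -kermx_eq0.
apply/rowV0P => u /sub_kermxP uC; apply: contraTeq kn => u0.
have := hwt_grs_code_ge xI v0 u0; rewrite uC /hwt.
rewrite (_ : [set i | _] = set0) ?cards0 ?ltnNge //.
by apply/setP => i; rewrite !inE mxE eqxx.
Qed.

(** The bound n - k + 1 is attained by the polynomial whose roots are the first k - 1 evaluation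
    points. *)
Lemma grs_code_MDS (F : fieldType) (k n : nat) (x v : 'I_n -> F) :
  injective x -> (forall i, v i != 0) -> (0 < k <= n)%N ->
  is_MDS (grs_code k x v).
Proof.
move=> xI v0 /andP[k0 kn]; rewrite /is_MDS /code_dim rank_grs_code //.
have wge (w : 'rV_n) : (w <= grs_code k x v)%MS -> w != 0 ->
    (n - k + 1 <= hwt w)%N.
  case/submxP=> u -> uC; have u0 : u != 0.
    by apply: contra uC => /eqP->; rewrite mul0mx.
  by have := hwt_grs_code_ge xI v0 u0; lia.
split=> //.
have kn1 : (k.-1 <= n)%N by lia.
pose y (j : 'I_k.-1) := x (widen_ord kn1 j).
have yI : injective y by move=> i j /xI/(congr1 val) ij; apply: val_inj.
pose f := \prod_(j < k.-1) ('X - (y j)%:P).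
have sf : size f = k.
  by rewrite size_prod_XsubC /index_enum -enumT size_enum_ord; lia.
pose u : 'rV_k := poly_rV f.
have fE : rVpoly u = f by rewrite poly_rV_K ?sf.
have u0 : u != 0.
  apply/eqP => u0; have := sf.
  by rewrite -fE u0 linear0 size_poly0 => k0'; rewrite -k0' in k0.
have uC := submxMl u (grs_code k x v).
have uC0 : u *m grs_code k x v != 0.
  apply: contra u0 => /eqP uC0; apply/eqP.
  apply: (row_free_inj (A := grs_code k x v)).
    by rewrite /row_free rank_grs_code.
  by rewrite uC0 mul0mx.
exists (u *m grs_code k x v); split=> //.
apply/eqP; rewrite eqn_leq wge // andbT.
rewrite -(leq_add2r #|[set i | root (rVpoly u) (x i)]|) hwt_grs_code //.
suff : (k.-1 <= #|[set i | root (rVpoly u) (x i)]|)%N by lia.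
rewrite -[leqLHS]card_ord -(card_imset _ (f := widen_ord kn1)); last first.
  by move=> i j /(congr1 val) ij; apply: val_inj.
apply/subset_leq_card/subsetP => _ /imsetP[j _ ->].
by rewrite inE fE /root horner_prod (bigD1 j) //= hornerXsubC subrr mul0r.
Qed.

(** The inner product of rows [a] and [b] is [c] times the Lagrange sum of X^(a+b), which vanishes
    because a + b <= 2k - 2 < n - 1. *)
Lemma grs_code_self_orthogonal (F : fieldType) (k n : nat) (x v : 'I_n -> F) (c : F) :
  injective x ->
  (forall i, v i ^+ 2 = c / \prod_(j | j != i) (x i - x j)) -> (2 * k <= n)%N ->
  self_orthogonal (grs_code k x v).
Proof.
move=> xI vE kn; apply/sub_kermxP/matrixP => a b; rewrite !mxE.
have sX : (size ('X^(a + b) : {poly F}) < n)%N.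
  by rewrite size_polyXn; have := ltn_ord a; have := ltn_ord b; lia.
rewrite -[RHS](mulr0 c) -[X in _ = c * X](sum_div_prod_sub_eq0 xI sX) mulr_sumr.
apply: eq_bigr => i _; rewrite !mxE hornerXn exprD.
have -> : v i * x i ^+ a * (v i * x i ^+ b) = v i ^+ 2 * (x i ^+ a * x i ^+ b).
  by ring.
by rewrite vE; ring.
Qed.

(** With c = P'(x_0) for one fixed root x_0, each c / P'(x) is the square c P'(x) divided by
    P'(x)^2, so the multipliers exist. *)
Lemma exists_self_orthogonal_MDS (F : fieldType) (rs : seq F) (n : nat) :
  uniq rs -> size rs = n ->
  {in rs &, forall y z, exists w : F,
     (\prod_(r <- rs) ('X - r%:P))^`().[y] * (\prod_(r <- rs) ('X - r%:P))^`().[z]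
       = w ^+ 2} ->
  forall k, (0 < k)%N -> (2 * k <= n)%N ->
    exists C : 'M[F]_(k, n),
      [/\ code_dim C = k, is_MDS C & self_orthogonal C].
Proof.
move=> Urs <- {n}; set P := \prod_(r <- rs) _ => sq k k0 kn.
pose x (i : 'I_(size rs)) := rs`_i.
have xI : injective x by move=> i j /eqP; rewrite nth_uniq // => /eqP/val_inj.
have PE : P = \prod_i ('X - (x i)%:P) by rewrite /P (big_nth 0) big_mkord.
have dE i : P^`().[x i] = \prod_(j | j != i) (x i - x j).
  by rewrite PE deriv_prod_XsubC_root.
have d0 i : P^`().[x i] != 0 by rewrite dE prod_sub_neq0.
have xrs i : x i \in rs by rewrite mem_nth.
have n0 : (0 < size rs)%N by lia.
pose c := P^`().[x (Ordinal n0)].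
have sqx i : exists w : F, w ^+ 2 == c / P^`().[x i].
  have [w wE] := sq _ _ (xrs (Ordinal n0)) (xrs i).
  by exists (w / P^`().[x i]); rewrite expr_div_n -wE -/c; apply/eqP; field.
pose v i := xchoose (sqx i).
have vE i : v i ^+ 2 = c / P^`().[x i] by apply/eqP/(xchooseP (sqx i)).
have v0 i : v i != 0.
  have := expf_eq0 (v i) 2; rewrite /= => <-.
  by rewrite vE mulf_neq0 ?invr_eq0 ?d0.
exists (grs_code k x v); split.
- by rewrite /code_dim rank_grs_code //; lia.
- by apply: grs_code_MDS => //; lia.
- by apply: (grs_code_self_orthogonal (c := c)) => // i; rewrite vE dE.
Qed.

(** * Squares and half-order powers in a finite field *)

Lemma exists_prim_root_finField (F : finFieldType) :
  exists z : F, (#|F|.-1).-primitive_root z.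
Proof.
have F1 := finNzRing_gt1 F.
have /hasP[z _ zP] : has (#|F|.-1).-primitive_root (enum (predC1 (0 : F))).
  apply: has_prim_root; rewrite ?enum_uniq //;
    first by rewrite -ltnS (ltn_predK F1).
    apply/allP => x; rewrite mem_enum inE => x0; rewrite unity_rootE.
    by apply/eqP/(mulfI x0); rewrite -exprS (ltn_predK F1) expf_card mulr1.
  by rewrite -cardE cardC1.
by exists z.
Qed.

(** Euler's criterion: for x = z^i with z primitive, x^h = 1 gives 2h | ih, so i is even. *)
Lemma square_of_exp_half (F : finFieldType) (h : nat) (x : F) :
  #|F|.-1 = (2 * h)%N -> x ^+ h = 1 -> exists w, x = w ^+ 2.
Proof.
move=> Fh xh; have [z zP] := exists_prim_root_finField F.
have h0 : (0 < h)%N by have := prim_order_gt0 zP; lia.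
have [|[i /= _] xE] := prim_rootP zP (x := x).
  by rewrite Fh mulnC exprM xh expr1n.
move: xh; rewrite xE -exprM => /eqP; rewrite -(prim_order_dvd zP) Fh.
rewrite dvdn_pmul2r // => /dvdnP[j ->]; exists (z ^+ j).
by rewrite -exprM.
Qed.

Lemma natr_expn_pchar (F : fieldType) (r n : nat) :
  [pchar F].-nat r -> n%:R ^+ r = n%:R :> F.
Proof.
move=> pr; have r0 : (0 < r)%N by case/andP: pr.
elim: n => [|n IH]; first by rewrite expr0n; case: r r0 {pr}.
by rewrite -addn1 natrD exprDn_pchar // IH expr1n.
Qed.

Lemma exp_half_subfield (F : fieldType) (r R : nat) (x : F) :
  (0 < r)%N -> x ^+ r = x -> x != 0 -> x ^+ (r.-1 * R) = 1.
Proof.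
move=> r0 xr x0; rewrite exprM; suff -> : x ^+ r.-1 = 1 by rewrite expr1n.
by apply: (mulfI x0); rewrite -exprS prednK // xr mulr1.
Qed.

(* In the subfield of order r every nonzero element is a square of the field of
   order r ^ 2, since r - 1 divides half of r ^ 2 - 1. *)
Lemma exp_half_sub_subfield (F : fieldType) (r R : nat) (x y : F) :
  [pchar F].-nat r -> x ^+ r = x -> y ^+ r = y -> x != y ->
  (x - y) ^+ (r.-1 * R) = 1.
Proof.
move=> pr xr yr xy; apply: exp_half_subfield; last by rewrite subr_eq0.
  by case/andP: pr.
by rewrite exprDn_pchar // exprNn_pchar // xr yr.
Qed.

(* Conjugation inverts elements of norm 1, so it maps x - y to
   - (x - y) / (x * y). *)
Lemma exp_half_sub_norm1 (F : fieldType) (r R : nat) (x y : F) :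
  [pchar F].-nat r -> x ^+ r.+1 = 1 -> y ^+ r.+1 = 1 -> x != y ->
  (x - y) ^+ (r.-1 * R) = (-1) ^+ R / (x ^+ R * y ^+ R).
Proof.
move=> pr x1 y1 xy; rewrite exprM -exprMn -exprVn -exprMn; congr (_ ^+ R).
have r0 : (0 < r)%N by case/andP: pr.
have nz (z : F) : z ^+ r.+1 = 1 -> z != 0.
  move=> z1; apply/eqP => z0; move: z1; rewrite z0 expr0n => /eqP.
  by rewrite eq_sym oner_eq0.
have x0 := nz x x1; have y0 := nz y y1.
have d0 : x - y != 0 by rewrite subr_eq0.
have conj (z : F) : z ^+ r.+1 = 1 -> z ^+ r = z^-1.
  by move=> z1; apply: (mulfI (nz z z1)); rewrite -exprS z1 divff ?nz.
apply: (mulfI d0); rewrite -exprS prednK // exprDn_pchar // exprNn_pchar // !conj //.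
by field; rewrite x0 y0.
Qed.

(** * Splitting of Q(X^f) into distinct linear factors *)

Lemma monic_dvd_split (F : finFieldType) (P : {poly F}) :
  P \is monic -> P %| 'X^(#|F|.-1) - 1 ->
  exists2 rs, uniq rs & P = \prod_(r <- rs) ('X - r%:P).
Proof.
move=> mP dP; have F1 := finNzRing_gt1 F.
have : P %| \prod_(x <- index_enum F) ('X - x%:P).
  rewrite -finField_genPoly -{1}(prednK (ltnW F1)) exprS.
  by rewrite -[X in _ - X]mulr1 -mulrBr dvdp_mull.
case/dvdp_prod_XsubC => m; rewrite eqp_monic ?monic_prod_XsubC // => /eqP ->.
by exists (mask m (index_enum F)); rewrite ?mask_uniq ?index_enum_uniq.
Qed.

(** The product Q of the X - g_i divides X^e - 1, hence Q(X^f) divides X^(ef) - 1 and has distinct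
    roots in F, as many as its degree n f. *)
Lemma split_comp_Xn (F : finFieldType) (e f n : nat) (g : 'I_n -> F) :
  (0 < f)%N -> #|F|.-1 = (e * f)%N -> injective g -> (forall i, g i ^+ e = 1) ->
  exists rs : seq F,
    [/\ uniq rs, size rs = (n * f)%N,
        (\prod_i ('X - (g i)%:P)) \Po 'X^f = \prod_(x <- rs) ('X - x%:P) &
        {in rs, forall x, exists i, x ^+ f = g i}].
Proof.
move=> f0 Fef gI ge; set Q := \prod_i _.
have mQ : Q \is monic by apply: monic_prod_XsubC.
have sQ : size Q = n.+1.
  by rewrite size_prod_XsubC /index_enum -enumT size_enum_ord.
have mX : ('X^f : {poly F}) \is monic by apply: monicXn.
have sX : size ('X^f : {poly F}) = f.+1 by rewrite size_polyXn.
have dQ : Q %| 'X^e - 1.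
  rewrite /Q -[index_enum _]enumT -(big_map g predT (fun x => 'X - x%:P)).
  apply: uniq_roots_dvdp; last first.
    by rewrite uniq_rootsE map_inj_uniq ?enum_uniq.
  by apply/allP => _ /mapP[i _ ->]; rewrite /root !hornerE ge subrr.
have mP : Q \Po 'X^f \is monic.
  by rewrite monicE lead_coef_comp ?sX // (monicP mQ) (monicP mX) expr1n mulr1.
have [rs Urs PE] : exists2 rs, uniq rs & Q \Po 'X^f = \prod_(r <- rs) ('X - r%:P).
  apply: monic_dvd_split => //; rewrite Fef mulnC exprM.
  by have := dvdp_comp_poly 'X^f dQ; rewrite comp_polyB comp_Xn_poly comp_polyC.
exists rs; split=> //.
  have := size_comp_poly Q 'X^f; rewrite PE size_prod_XsubC sQ sX /=.
  by move=> [].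
move=> x xrs; have : root (Q \Po 'X^f) x by rewrite PE root_prod_XsubC.
rewrite /root horner_comp hornerXn horner_prod prodf_seq_eq0 => /hasP[i _ /=].
by rewrite hornerXsubC subr_eq0 => /eqP; exists i.
Qed.

(** The first factor vanishes at [x], so only its derivative survives in the product rule. *)
Lemma deriv_comp_Xn_mul (F : fieldType) (f n : nat) (g : 'I_n -> F) (S : {poly F})
    (x : F) (i : 'I_n) :
  x ^+ f = g i ->
  (((\prod_j ('X - (g j)%:P)) \Po 'X^f) * S)^`().[x] =
    \prod_(j | j != i) (g i - g j) * (f%:R * x ^+ f.-1) * S.[x].
Proof.
move=> xf; rewrite derivM deriv_comp derivXn hornerD !hornerM !horner_comp.
rewrite hornerXn xf deriv_prod_XsubC_root hornerMn hornerXn mulr_natl.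
suff -> : (\prod_j ('X - (g j)%:P)).[g i] = 0 by rewrite mul0r addr0.
by rewrite horner_prod (bigD1 i) //= hornerXsubC subrr mul0r.
Qed.

Lemma natr_card_finField (F : finFieldType) : #|F|%:R = 0 :> F.
Proof. by have := @expg_cardG F [set: F]%G 1%R (in_setT _); rewrite cardsT. Qed.

(** * Congruences of exponents and the evaluation points *)

(** After division by the gcd, e becomes invertible modulo N / gcd, where i and j are already
    reduced. *)
Lemma eqn_mod_mul_inj (N e i j : nat) :
  (0 < N)%N -> (i < N %/ gcdn N e)%N -> (j < N %/ gcdn N e)%N ->
  e * i = e * j %[mod N] -> i = j.
Proof.
move=> N0; wlog ij : i j / (j <= i)%N => [W iD jD eij|].
  by case: (leqP j i) => [|/ltnW] ij; [|apply/esym]; apply: W.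
move=> iD jD /eqP; rewrite eqn_mod_dvd ?leq_mul // -mulnBr.
have g0 : (0 < gcdn N e)%N by rewrite gcdn_gt0 N0.
have cop : coprime (N %/ gcdn N e) (e %/ gcdn N e).
  rewrite /coprime -(eqn_pmul2r g0) muln_gcdl mul1n.
  by rewrite !divnK ?dvdn_gcdl ?dvdn_gcdr.
rewrite -{1}(divnK (dvdn_gcdl N e)) -{3}(divnK (dvdn_gcdr N e)) mulnAC.
rewrite dvdn_pmul2r // Gauss_dvdr // => /dvdn_leq.
by case: (posnP (i - j)) => [|_ /(_ isT)]; lia.
Qed.

(** A congruence without subtraction, so that divisibility passes from one side to the other. *)
Lemma eqn_mod_addl_mul (a b d : nat) :
  a = b %[mod d] -> exists u v, (a + u * d = b + v * d)%N.
Proof.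
move=> ab; exists (b %/ d)%N, (a %/ d)%N.
by rewrite {1}(divn_eq a d) {2}(divn_eq b d) ab; lia.
Qed.

(* In the notation of the theorem, e1 = 2 * c, R = (r + 1) / 2,
   E = e1 * (r + 1) / (2 * e2) and M = 2 ^ (l - 1). *)
Lemma exists_square_class_points (F : finFieldType)
    (r R E c M w f1 e2 f2 s t : nat) :
  [pchar F].-nat r -> r.+1 = (2 * R)%N -> #|F|.-1 = (2 * (r.-1 * R))%N ->
  (0 < f1)%N -> (0 < f2)%N ->
  #|F|.-1 = (2 * c * f1)%N -> #|F|.-1 = (e2 * f2)%N ->
  (2 * c * R = e2 * E)%N -> (2 * c %| e2 * r.-1)%N ->
  c = (M * w)%N -> odd w -> (2 %| M)%N -> (2 * M %| e2)%N ->
  (s <= 2 * c %/ gcdn (2 * c) e2)%N -> (t <= e2 %/ gcdn (2 * c) e2)%N ->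
  exists rs : seq F,
    [/\ uniq rs, size rs = (s * f1 + t * f2)%N,
        {in rs, forall x, x ^+ (r.-1 * R) = 1} &
        {in rs, forall x, let d := (\prod_(y <- rs) ('X - y%:P))^`().[x] in
           d ^+ (r.-1 * R) = (-1) ^+ (t * (R + E)) \/
           d ^+ (r.-1 * R) = (-1) ^+ (t.-1 * R)}].
Proof.
move=> pr rR Nh f10 f20 Ne1 Ne2 cRE.
case/dvdnP=> k e1d cM ow M2 Me2 sD tD.
set h := (r.-1 * R)%N in Nh *.
have [z zP] := exists_prim_root_finField F.
have N0 := prim_order_gt0 zP.
have h0 : (0 < h)%N by move: N0; rewrite Nh muln_gt0 => /andP[].
have c0 : (0 < 2 * c)%N by move: N0; rewrite Ne1 muln_gt0 => /andP[].
have e20 : (0 < e2)%N by move: N0; rewrite Ne2 muln_gt0 => /andP[].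
(* The values of x^f1 at the roots of P1 and of x^f2 at the roots of P2. The bounds on [s] and [t]
   make them pairwise distinct. *)
pose gA (i : 'I_s) := z ^+ (e2 * f1 * i).
pose gB (j : 'I_t) := z ^+ ((2 * j).+1 * c * f2).
have gAI : injective gA.
  move=> i j /eqP; rewrite (eq_prim_root_expr zP) Ne1.
  rewrite !(mulnAC e2 f1) -!muln_modl eqn_pmul2r //
    => /eqP /eqn_mod_mul_inj ij; apply/val_inj/ij => //.
  - exact: leq_trans (ltn_ord i) sD.
  - exact: leq_trans (ltn_ord j) sD.
have gBI : injective gB.
  have oddE (j : nat) : ((2 * j).+1 * c = 2 * c * j + c)%N.
    by rewrite mulSn addnC -mulnAC.
  move=> i j /eqP; rewrite (eq_prim_root_expr zP) Ne2 -!muln_modl eqn_pmul2r //.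
  rewrite !oddE eqn_modDr => /eqP /eqn_mod_mul_inj ij; rewrite gcdnC in tD.
  apply/val_inj/ij => //.
  - exact: leq_trans (ltn_ord i) tD.
  - exact: leq_trans (ltn_ord j) tD.
move=> {sD tD}.
have r0 : (0 < r)%N by case/andP: pr.
have rE : r.-1 = (2 * R.-1)%N by lia.
have zh : z ^+ h = -1.
  have : (z ^+ h) ^+ 2 == 1 by rewrite -exprM mulnC -Nh prim_expr_order.
  rewrite sqrf_eq1 -(prim_order_dvd zP) Nh => /orP[/dvdn_leq|/eqP //].
  by rewrite h0 => /(_ isT); lia.
have z1 a : (#|F|.-1 %| a)%N -> z ^+ a = 1.
  by rewrite (prim_order_dvd zP) => /eqP.
have cRf : (c * R * f2 = h * E)%N.
  apply/eqP; rewrite -(eqn_pmul2l (isT : (0 < 2)%N)) [(2 * (h * E))%N]mulnA.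
  rewrite -Nh Ne2.
  by rewrite !mulnA cRE mulnAC.
have gA1 i : gA i ^+ (2 * c) = 1.
  rewrite -exprM z1 // Ne1; apply/dvdnP; exists (e2 * i)%N; lia.
have gB1 j : gB j ^+ e2 = 1.
  rewrite -exprM z1 // Ne2; apply/dvdnP; exists ((2 * j).+1 * c)%N; lia.
have gAr i : gA i ^+ r = gA i.
  rewrite -{1}(prednK r0) exprS -exprM z1 ?mulr1 // Ne1.
  apply/dvdnP; exists (k * i)%N.
  rewrite (_ : (e2 * f1 * i * r.-1)%N = (e2 * r.-1 * (f1 * i))%N); last lia.
  by rewrite e1d; lia.
(* Since z^h = -1, this power is (-1)^(E (2j+1)), which does not depend on [j]; its square gives
   norm 1. *)
have gBR j : gB j ^+ R = (-1) ^+ E.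
  rewrite -exprM (_ : (_ * R)%N = (h * (E * (2 * j).+1))%N); last first.
    rewrite (_ : (_ * c * f2 * R = c * R * f2 * (2 * j).+1)%N); last lia.
    by rewrite cRf; lia.
  rewrite exprM zh exprM -signr_odd; case: (odd E); last by rewrite expr1n.
  by rewrite expr1 -[LHS]signr_odd /= oddM.
have gBn j : gB j ^+ r.+1 = 1.
  by rewrite rR mulnC exprM gBR sqrr_sign.
have [rsA [UA sA PA rootA]] := split_comp_Xn f10 Ne1 gAI gA1.
have [rsB [UB sB PB rootB]] := split_comp_Xn f20 Ne2 gBI gB1.
have e1R a : (a * (2 * c) * (f2 * R) = a * E * (e2 * f2))%N.
  rewrite (_ : (a * (2 * c) * _ = a * f2 * (2 * c * R))%N); last lia.
  by rewrite cRE; lia.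
have e2r a : (a * e2 * (f1 * r.-1) = a * k * (2 * c * f1))%N.
  rewrite (_ : (a * e2 * _ = a * f1 * (e2 * r.-1))%N); last lia.
  by rewrite e1d; lia.
(* From x^f1 = [gA i] follows m = e2 i modulo 2c, and 2M divides both e2 and 2c. For the last claim,
   e2 i f2 R and 2c f2 R = E e2 f2 are multiples of the group order. *)
have logA x : x \in rsA -> exists m : nat,
    [/\ x = z ^+ m, (2 * M %| m)%N & (x ^+ f2) ^+ R = 1].
  case/rootA => i xi; have [|[m /= _] xm] := prim_rootP zP (x := x).
    by rewrite Ne1 mulnC exprM xi gA1.
  exists m; split=> //.
    move: xi; rewrite xm -exprM /gA => /eqP.
    rewrite (eq_prim_root_expr zP) Ne1 (mulnAC e2 f1) -!muln_modl eqn_pmul2r //.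
    case/eqP/eqn_mod_addl_mul => u [v uv].
    have Mc : (2 * M %| 2 * c)%N by rewrite cM mulnA dvdn_mulr.
    rewrite -(dvdn_addl _ (dvdn_mull u Mc)) uv.
    by apply: dvdn_add; [exact: dvdn_mulr|exact: dvdn_mull].
  move: xi; rewrite xm -!exprM /gA => /eqP.
  rewrite (eq_prim_root_expr zP) {1 2}Ne1 (mulnAC e2 f1) -!muln_modl.
  rewrite eqn_pmul2r //.
  case/eqP/eqn_mod_addl_mul => u [v uv]; apply: z1.
  rewrite -(@dvdn_addl (u * (2 * c) * (f2 * R))).
    rewrite -mulnDl uv mulnDl dvdn_add // Ne2.
      by apply/dvdnP; exists (i * R)%N; lia.
    by rewrite e1R dvdn_mull.
  by rewrite e1R -Ne2 dvdn_mull.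
(* Here m = (2j+1) c modulo e2 with c = M w and w odd, so m is an odd multiple of M modulo 2M; it is
   even because M is. *)
have logB x : x \in rsB -> exists m : nat,
    [/\ x = z ^+ m, (2 %| m)%N, ~~ (2 * M %| m)%N & (x ^+ f1) ^+ r = x ^+ f1].
  case/rootB => j xj; have [|[m /= _] xm] := prim_rootP zP (x := x).
    by rewrite Ne2 mulnC exprM xj gB1.
  move: xj; rewrite xm -[_ ^+ f2]exprM /gB => /eqP.
  rewrite (eq_prim_root_expr zP) Ne2 -!muln_modl eqn_pmul2r //.
  case/eqP/eqn_mod_addl_mul => u [v uv]; exists m; split=> //.
  - have e2e : (2 %| e2)%N by apply: dvdn_trans Me2; rewrite dvdn_mulr.
    rewrite -(dvdn_addl _ (dvdn_mull u e2e)) uv.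
    by apply: dvdn_add; rewrite ?cM; apply: dvdn_mull => //; exact: dvdn_mulr.
  - rewrite -(dvdn_addl _ (dvdn_mull u Me2)) uv (dvdn_addl _ (dvdn_mull v Me2)).
    have M0 : (0 < M)%N by case: (M) cM c0 => // ->.
    rewrite cM (_ : (_ * (M * w) = (2 * j).+1 * w * M)%N); last by lia.
    by rewrite dvdn_pmul2r // dvdn2 oddM /= oddM ow.
  - rewrite -{1}(prednK r0) exprS -!exprM [X in _ * X]z1 ?mulr1 //.
    rewrite -(@dvdn_addl (u * e2 * (f1 * r.-1))).
      rewrite -mulnDl uv mulnDl dvdn_add // Ne1.
        by apply/dvdnP; exists ((2 * j).+1 * R.-1)%N; rewrite rE; lia.
      by rewrite e2r dvdn_mull.
    by rewrite e2r -Ne1 dvdn_mull.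
(* As 2M divides the group order, divisibility of the exponent by 2M depends only on the element and
   separates the two sets of roots. *)
have disj : ~~ has (mem rsA) rsB.
  apply/hasPn => x /logB [m [xm _ nMm _]]; apply/negP => /logA [m' [xm' Mm' _]].
  move: xm' nMm; rewrite xm => /eqP; rewrite (eq_prim_root_expr zP) => /eqP.
  case/eqn_mod_addl_mul => u [v uv] /negP; apply.
  have MN : (2 * M %| #|F|.-1)%N by rewrite Ne2 dvdn_mulr.
  rewrite -(dvdn_addl _ (dvdn_mull u MN)) uv.
  by apply: dvdn_add => //; exact: dvdn_mull.
have PE : \prod_(y <- rsA ++ rsB) ('X - y%:P) =
   ((\prod_i ('X - (gA i)%:P)) \Po 'X^f1) *
   ((\prod_i ('X - (gB i)%:P)) \Po 'X^f2).
  by rewrite big_cat PA PB.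
have even1 m : (2 %| m)%N -> (z ^+ m) ^+ h = 1.
  by case/dvdnP=> n ->; rewrite -exprM z1 // Nh; apply/dvdnP; exists n; lia.
have sq1 x : x \in rsA ++ rsB -> x ^+ h = 1.
  rewrite mem_cat => /orP[/logA [m [-> Mm _]]|/logB [m [-> m2 _ _]]];
    apply: even1 => //.
  by apply: dvdn_trans Mm; rewrite dvdn_mulr.
(* Integers lie in the subfield of order r. Both f1 and f2 are nonzero in F because they divide q -
   1, which is -1 there. *)
have nat1 n : (n%:R : F) != 0 -> n%:R ^+ h = 1 :> F.
  exact/exp_half_subfield/natr_expn_pchar.
have N10 : (#|F|.-1)%:R != 0 :> F.
  have F1 := finNzRing_gt1 F.
  apply/eqP => N1; have /eqP := natr_card_finField F.
  by rewrite -(ltn_predK F1) -natr1 N1 add0r oner_eq0.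
have f1h : f1%:R ^+ h = 1 :> F.
  by apply: nat1; apply: contraNneq N10; rewrite Ne1 natrM => ->; rewrite mulr0.
have f2h : f2%:R ^+ h = 1 :> F.
  by apply: nat1; apply: contraNneq N10; rewrite Ne2 natrM => ->; rewrite mulr0.
have nAB x j : x \in rsA -> x ^+ f2 != gB j.
  move=> xA; apply: contra disj => /eqP xj; apply/hasP; exists x => //.
  rewrite -root_prod_XsubC -PB /root horner_comp hornerXn xj horner_prod.
  by rewrite (bigD1 j) //= hornerXsubC subrr mul0r.
have nBA x i : x \in rsB -> x ^+ f1 != gA i.
  move=> xB; apply: contra disj => /eqP xi; apply/hasP; exists x => //.
  rewrite /= -root_prod_XsubC -PA /root horner_comp hornerXn xi horner_prod.
  by rewrite (bigD1 i) //= hornerXsubC subrr mul0r.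
exists (rsA ++ rsB); split=> //.
- by rewrite cat_uniq UA UB andbT.
- by rewrite size_cat sA sB.
move=> x xAB; have xh := sq1 x xAB.
move: xAB; rewrite mem_cat PE => /orP[] xr /=; [left|right].
  (* At a root of P1, the differences of the [gA] and the factor f1 x^(f1-1) contribute 1, and each
     of the t factors x^f2 - [gB j] contributes (-1)^(R+E). *)
  have [i xi] := rootA x xr; have [m [_ _ xR]] := logA x xr.
  rewrite (deriv_comp_Xn_mul _ xi) !exprMn f1h exprAC xh expr1n !mulr1.
  rewrite -prodrXl big1 ?mul1r => [|j ji]; last first.
    by rewrite exp_half_sub_subfield // (inj_eq gAI) eq_sym.
  rewrite horner_comp hornerXn horner_prod -prodrXl.
  rewrite (eq_bigr (fun=> (-1) ^+ (R + E))) => [|j _].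
    by rewrite prodr_const card_ord -exprM mulnC.
  rewrite hornerXsubC exp_half_sub_norm1 ?nAB //; last first.
    by rewrite rR mulnC exprM xR expr1n.
  by rewrite xR gBR mul1r invr_sign exprD.
(* At a root of P2, the s factors x^f1 - [gA i] contribute 1, and each of the t - 1 differences of
   the [gB] contributes (-1)^R. *)
have [j xj] := rootB x xr; have [m [_ _ _ xR]] := logB x xr.
rewrite mulrC (deriv_comp_Xn_mul _ xj) !exprMn f2h exprAC xh expr1n !mulr1.
rewrite horner_comp hornerXn horner_prod -[X in _ * X]prodrXl.
rewrite [X in _ * X]big1 ?mulr1 => [|i _]; last first.
  by rewrite hornerXsubC exp_half_sub_subfield // nBA.
rewrite -prodrXl (eq_bigr (fun=> (-1) ^+ R)) => [|i ij].
  by rewrite prodr_const cardC1 card_ord -exprM mulnC.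
rewrite exp_half_sub_norm1 // ?(inj_eq gBI) 1?eq_sym //.
by rewrite !gBR -expr2 sqrr_sign divr1.
Qed.

(** * Adjoining the point 0 and deriving the three cases *)

(** The derivative of X P is P(0) at 0 and x P'(x) at a root x of P. Moreover P(0) is the product of
    the -y over the roots y, and (-1)^h = 1 for even h. *)
Lemma deriv_cons0_exp1 (F : fieldType) (h : nat) (rs : seq F) :
  (0 < h)%N -> ~~ odd h -> uniq rs ->
  {in rs, forall x, x ^+ h = 1} ->
  {in rs, forall x, (\prod_(y <- rs) ('X - y%:P))^`().[x] ^+ h = 1} ->
  uniq (0 :: rs) /\
  {in 0 :: rs, forall x, (\prod_(y <- 0 :: rs) ('X - y%:P))^`().[x] ^+ h = 1}.
Proof.
move=> h0 eh Urs xh dh; split.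
  rewrite /= Urs andbT; apply/negP => /xh /eqP.
  by rewrite expr0n eqn0Ngt h0 eq_sym oner_eq0.
move=> x; rewrite big_cons derivM derivXsubC mul1r subr0 hornerD hornerM hornerX.
rewrite inE => /orP[/eqP ->|xrs].
  rewrite mul0r addr0 horner_prod -prodrXl big_seq big1 // => y yrs.
  by rewrite hornerXsubC sub0r exprNn (xh y) // -signr_odd (negPf eh) mulr1.
have /rootP -> : root (\prod_(y <- rs) ('X - y%:P)) x by rewrite root_prod_XsubC.
by rewrite add0r exprMn xh // dh // mulr1.
Qed.

Unset Implicit Arguments.
Local Close Scope ring_scope.

Theorem theorem4 (F : finFieldType) (p a r q e1 f1 e2 f2 l s t : nat) :
  prime p -> odd p -> (0 < a)%N -> r = (p ^ a)%N -> q = (r ^ 2)%N ->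
  #|F| = q ->
  (0 < e1)%N -> (0 < f1)%N -> (0 < e2)%N -> (0 < f2)%N ->
  (q - 1)%N = (e1 * f1)%N -> (q - 1)%N = (e2 * f2)%N ->
  (2 <= l)%N -> (e1 %% 2 ^ l.+1)%N = (2 ^ l)%N -> (2 ^ l %| e2)%N ->
  (2 * e2 %| e1 * (r + 1))%N -> (e1 %| e2 * (r - 1))%N ->
  let D1 := (e1 %/ gcdn e1 e2)%N in
  let D2 := (e2 %/ gcdn e1 e2)%N in
  (1 <= s <= D1)%N -> (1 <= t <= D2)%N ->
  let n1 := (s * f1 + t * f2)%N in
  [/\
   (* (1) *)
   (~~ odd (t * e1 * (r + 1) %/ (2 * e2) + (r + 1) %/ 2) -> ~~ odd n1 ->
    forall k : nat, (1 <= k <= n1 %/ 2 - 1)%N ->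
      exists (m : nat) (C : 'M[F]_(m, n1)),
        [/\ code_dim C = k, is_MDS C & self_orthogonal C]),
   (* (2) *)
   (~~ odd (t * (r + 1) * e1 %/ (2 * e2)) -> ~~ odd ((r + 1) %/ 2) -> ~~ odd n1 ->
      exists (m : nat) (C : 'M[F]_(m, n1.+1)),
        is_MDS C /\ almost_self_dual C) &
   (* (3) *)
   (~~ odd (t * e1 * (r + 1) %/ (2 * e2) + t * (r + 1) %/ 2) ->
    ~~ odd ((t - 1) * (r + 1) %/ 2) -> odd n1 ->
    forall k : nat, (1 <= k <= n1.+1 %/ 2 - 1)%N ->
      exists (m : nat) (C : 'M[F]_(m, n1.+1)),
        [/\ code_dim C = k, is_MDS C & self_orthogonal C])].
Proof.
have half_le (k n : nat) : k <= n %/ 2 - 1 -> 2 * k <= n by lia.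
have sub_half (n : nat) : n = 2 * n./2 -> n.+1 - n./2 = n./2 + 1 by lia.
move=> p_pr p_odd a0 rE qE cF e10 f10 e20 f20 q1 q2 l2 e1l e2l e1e2 e2e1 D1 D2.
move=> /andP[s0 sD] /andP[t0 tD] n1.
have r_odd : odd r by rewrite rE oddX p_odd orbT.
have pr : [pchar F]%R.-nat r.
  rewrite rE pnatX pnatE //; apply/orP; left.
  by apply: (@card_finPcharP F p (a * 2)); rewrite // cF qE rE expnM.
case/dvdnP: e1e2 => E e1E.
pose R := (r + 1) %/ 2; pose h := r.-1 * R.
have rR : r + 1 = 2 * R.
  by rewrite mulnC divnK // dvdn2 oddD r_odd.
have Fh : #|F|.-1 = 2 * h.
  have r0 : 0 < r by rewrite odd_gt0.
  rewrite cF qE -subn1 -[X in _ - X](exp1n 2) subn_sqr rR subn1 /h; lia.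
have h0 : 0 < h.
  by rewrite -(ltn_pmul2l (isT : 0 < 2)) -Fh -subn1 cF q1 muln0 muln_gt0 e10.
have h_even : ~~ odd h by rewrite /h oddM -subn1 oddB ?odd_gt0 // r_odd.
(* The congruence for e1 says e1 = 2^l w with w = 2v + 1 odd; thus M = 2^(l-1), which is even
   because l >= 2. *)
pose v := e1 %/ 2 ^ l.+1; pose w := (v * 2).+1.
have Ml : 2 ^ l = 2 * 2 ^ l.-1 by rewrite -expnS (ltn_predK l2).
have e1w : e1 = 2 * (2 ^ l.-1 * w).
  have -> : e1 = v * 2 ^ l.+1 + 2 ^ l by rewrite -e1l -divn_eq.
  by rewrite expnS Ml /w mulnA -mulSnr mulnCA (mulnC _ w) mulnA.
have tE : t * e1 * (r + 1) %/ (2 * e2) = t * E.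
  by rewrite -mulnA e1E mulnA mulnK // muln_gt0.
have tR n : n * (r + 1) %/ 2 = n * R by rewrite rR mulnCA mulKn.
have [rs [Urs srs xh dh]] : exists rs : seq F,
    [/\ uniq rs, size rs = n1,
        {in rs, forall x, x ^+ h = 1}%R &
        {in rs, forall x, let d := (\prod_(y <- rs) ('X - y%:P))^`().[x] in
           d ^+ h = (-1) ^+ (t * (R + E)) \/ d ^+ h = (-1) ^+ (t.-1 * R)}%R].
  apply: (@exists_square_class_points F r R E (2 ^ l.-1 * w) (2 ^ l.-1) w
           f1 e2 f2) => //.
  - by rewrite -rR addn1.
  - by rewrite -e1w -q1 cF subn1.
  - by rewrite -q2 cF subn1.
  - rewrite -e1w; apply/eqP; rewrite -(eqn_pmul2l (isT : 0 < 2)); apply/eqP.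
    by rewrite mulnCA -rR e1E; lia.
  - by rewrite -e1w -subn1.
  - by rewrite /w /= oddM andbF.
  - by rewrite dvdn_exp // -ltnS (ltn_predK l2).
  - by rewrite -Ml.
  - by rewrite -e1w.
  - by rewrite -e1w.
have even1 n : ~~ odd n -> ((-1) ^+ n = 1 :> F)%R.
  by move=> /negPf n_even; rewrite -signr_odd n_even.
(* The product of two derivatives has h-th power [eps] squared, which is 1, so it is a square. *)
have codes n (ps : seq F) (eps : F) : uniq ps -> size ps = n ->
    (eps ^+ 2 = 1)%R ->
    {in ps, forall x, (\prod_(y <- ps) ('X - y%:P))^`().[x] ^+ h = eps}%R ->
    forall k, 0 < k -> 2 * k <= n -> exists C : 'M[F]_(k, n),
      [/\ code_dim C = k, is_MDS C & self_orthogonal C].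
  move=> Ups sps eps2 psh; apply: (exists_self_orthogonal_MDS Ups sps) => x y xps yps.
  by apply: (@square_of_exp_half F h); rewrite // exprMn !psh // -expr2.
have codes0 : ~~ odd (t * (R + E)) -> ~~ odd (t.-1 * R) ->
    forall k, 0 < k -> 2 * k <= n1.+1 -> exists C : 'M[F]_(k, n1.+1),
      [/\ code_dim C = k, is_MDS C & self_orthogonal C].
  move=> oA oB; have [|U0 d0] := deriv_cons0_exp1 h0 h_even Urs xh.
    by move=> x /dh /=; rewrite !even1 // => -[].
  by apply: (codes _ (0%R :: rs) 1%R) => //=; rewrite ?srs ?expr1n.
have n1_gt1 : 1 < n1 by apply: (@leq_add 1 1); rewrite muln_gt0 ?s0 ?t0.
split.
- rewrite tE => o1 _ k /andP[k0 kn].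
  have [||C CP] := codes n1 rs ((-1) ^+ (t.-1 * R))%R Urs srs (sqrr_sign _ _) _ k k0.
  (* The two signs agree because t (R + E) and (t - 1) R differ by t E + R, which is even. *)
  + move=> x /dh /= [] -> //; rewrite -signr_odd -[in RHS]signr_odd.
    congr (_ ^+ _)%R; move: o1; rewrite -/R -{1 2}(prednK t0) !oddM oddS !oddD !oddM.
    by case: (odd t.-1) (odd R) (odd E) => [] [] [].
  + exact: half_le.
  by exists k, C.
(* Evenness of R and t E makes both signs 1. Dimension n1/2 in length n1 + 1 leaves dimension n1/2 +
   1 for the dual. *)
- rewrite -mulnA (mulnC (r + 1)) mulnA tE => o1 o2 o3.
  have n1E : n1 = 2 * n1./2 by rewrite mul2n even_halfK.
  have [||||C [Cd CM Co]] := codes0 _ _ n1./2.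
  + by move: o1 o2; rewrite -/R !oddM oddD;
      case: (odd t) (odd R) (odd E) => [] [] [].
  + by move: o2; rewrite -/R oddM => /negPf ->; rewrite andbF.
  + by rewrite half_gt0.
  + by rewrite -n1E.
  exists n1./2, C; split=> //; split=> //.
  by rewrite /dual_code mxrank_ker mxrank_tr -/(code_dim C) Cd; apply: sub_half.
(* The two parity hypotheses say directly that both signs are 1. *)
- rewrite tE !tR => o1 o2 o3 k /andP[k0 kn].
  have [|||C CP] := codes0 _ _ k k0.
  + by move: o1; rewrite oddD !oddM oddD;
      case: (odd t) (odd R) (odd E) => [] [] [].
  + by rewrite -subn1.
  + exact: half_le.
  by exists k, C.
Qed.
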